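(* Let $M$ be a smooth manifold, let $\Phi$ be a continuous semi-process on $M$, and let $W \subset M \times \mathbb{R}$ be an open set with $W \cap \{t=0\} \neq \varnothing$. Suppose that $W^- = W^{--}$ (with respect to $\Phi$) and that $W_0^{--} \neq \varnothing$. Let $x_0 \in M$ be a uniformly Lyapunov stable equilibrium of $\Phi$, and let $U \subset M$ be an open subset with $x_0 \in U$ and $\bar U \times \mathbb{R} \subset W$. Suppose that there is a continuous path $\Gamma \colon [0,1] \to M \times \mathbb{R}$ such that $\Gamma(s) \in W_0$ for all $s \in (0,1)$, $\Gamma(0) = (x_0,0)$, and $\Gamma(1) \in W_0^{--}$. Then $x_0$ is not globally attractive for $\Phi$.
   Context: A continuous semi-process on $M$ is a continuous map $\Phi \colon M \times \mathbb{R} \times [0,\infty) \to M$, written $\Phi_{t_0,t}(x) = \Phi(x,t_0,t)$, such that $\varphi(x,t_0,t) = (\Phi(x,t_0,t),\, t_0+t)$ is a continuous semi-flow on $M \times \mathbb{R}$; that is, $\varphi\colon M\times\mathbb{R}\times[0,\infty)\to M\times\mathbb{R}$ is continuous, $\varphi(x,t_0,0) = (x,t_0)$ for all $(x,t_0)$, and $\varphi(x,t_0,t+s) = \varphi(\varphi(x,t_0,t),s)$ for all $(x,t_0)$ and all $t,s \ge 0$. Points of $M\times\mathbb{R}$ are written $(x,t)$. Half-trajectory (initial time fixed to be $0$): $\gamma_\tau(x) = \bigcup_{t \in [0,\tau)} \{(\Phi_{0,t}(x),t)\} \subset M \times \mathbb{R}$. Time of egress: for $(x,0) \in W$, $\sigma(x)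 = \sup\{\tau \ge 0 : \gamma_\tau(x) \subset W\} \in [0,\infty]$; for $(x,0) \in \partial W$, $\sigma(x) = 0$. Here $\partial W$ is the boundary of $W$ in $M\times\mathbb{R}$. Egress points: a point $(x_1,t_1) \in \partial W$ with $t_1 > 0$ is an egress point if there is $(x,0) \in W$ with $(x_1,t_1) = (\Phi_{0,\sigma(x)}(x),\sigma(x))$. A point $(x_1,0) \in \partial W$ is an egress point if for some $\varepsilon>0$ one has $(\Phi_{0,t}(x_1),t) \notin W \cup \partial W$ for all $t \in (0,\varepsilon)$. The set of all egress points is $W^-$. Strict egress points: an egress point $(x_1,t_1) = (\Phi_{0,\sigma(x)}(x),\sigma(x))$ (with $x$ as in the definition of egress point; $x = x_1$, $\sigma(x)=0$ if $t_1=0$) is a strict egress point if for some $\varepsilon>0$ one has $(\Phi_{0,\sigma(x)+t}(x),\sigma(x)+t) \notin W \cup \partial W$ for all $t \in (0,\varepsilon)$. The set of all strict egress points is $W^{--}$. Sections: for $S \subset M \times \mathbb{R}$, $S_\tau = \{(x,t) \in S : t = \tau\}$; in particular $W_0$ is the section of $W$ at $t=0$ and $W_0^{--} = (W^{--})_0$. Equilibrium: $x_0 \in M$ is an equilibrium if $\Phi_{t_0,t}(x_0) = x_0$ for all $t_0 \ge 0$ and $t \ge 0$. Uniform Lyapunov stability: an equilibrium $x_0$ is uniformly Lyapunov stable (uniformly stable) if for any open set $U \subset M$ with $x_0 \in U$ there is an open set $V \subset M$ with $x_0 \in V$ such that $\Phi_{t_0,t}(x) \in U$ for all $x \in V$,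 all $t_0 \ge 0$ and all $t \ge 0$. Global attractivity: $x_0$ is globally attractive if $\Phi_{0,t}(x) \to x_0$ as $t \to \infty$ for every $x \in M$. *)

(* Defs.v *)
From HB Require Import structures.
From mathcomp Require Import all_boot all_order all_algebra.
From mathcomp Require Import all_classical all_reals all_analysis.
Import Order.TTheory GRing.Theory Num.Theory numFieldNormedType.Exports.

Set Implicit Arguments.
Unset Strict Implicit.
Unset Printing Implicit Defensive.

Local Open Scope classical_set_scope.
Local Open Scope ring_scope.

(* Smooth manifolds: second countable Hausdorff spaces with a C^oo atlas
   modelled on open subsets of R^n ('rV[R]_n). *)

(* [f] is only relevant on the open set [O]: all the notions involved at a
   point of [O] depend on the germ of [f] at that point. *)
Fixpoint Ck_on (R : realType) (m n k : nat) (O : set 'rV[R]_m)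
    (f : 'rV[R]_m -> 'rV[R]_n) : Prop :=
  (forall x, O x -> {for x, continuous f}) /\
  (if k is k'.+1 then
     forall i : 'I_m,
       (forall x, O x -> derivable f x (delta_mx 0 i)) /\
       Ck_on k' O ('D_(delta_mx 0 i) f)
   else True).

Definition smooth_on (R : realType) (m n : nat) (O : set 'rV[R]_m)
    (f : 'rV[R]_m -> 'rV[R]_n) : Prop :=
  forall k, Ck_on k O f.

(* The total functions [chart_map] and [chart_inv] are only meaningful on the
   open sets [chart_dom] and [chart_map @` chart_dom] respectively. *)
Record chart (R : realType) (n : nat) (M : topologicalType) := Chart {
  chart_dom : set M;
  chart_map : M -> 'rV[R]_n;
  chart_inv : 'rV[R]_n -> M;
  chart_dom_open : open chart_dom;
  chart_cod_open : open (chart_map @` chart_dom);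
  chart_mapK : forall x, chart_dom x -> chart_inv (chart_map x) = x;
  chart_map_continuous : {within chart_dom, continuous chart_map};
  chart_inv_continuous :
    {within chart_map @` chart_dom, continuous chart_inv}
}.

Record smooth_manifold (R : realType) (n : nat) := SmoothManifold {
  manifold_space :> topologicalType;
  manifold_hausdorff : hausdorff_space manifold_space;
  manifold_second_countable : @second_countable manifold_space;
  manifold_atlas : set (chart R n manifold_space);
  manifold_atlas_cover :
    forall x, exists2 c, manifold_atlas c & chart_dom c x;
  manifold_atlas_smooth : forall c d, manifold_atlas c -> manifold_atlas d ->
    smooth_on (chart_map c @` (chart_dom c `&` chart_dom d))
              (chart_map d \o chart_inv c)
}.

Definition boundary (T : topologicalType) (A : set T) : set T :=
  closure A `\` interior A.

(* Maps whose time domain is [0, +oo[ are represented by total functions on R;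
   their values at negative times are unconstrained and never used. *)

Record continuous_semiflow (R : realType) (X : topologicalType)
    (phi : X -> R -> X) : Prop := ContinuousSemiflow {
  semiflow_continuous :
    {within [set p : X * R | 0 <= p.2], continuous (fun p => phi p.1 p.2)};
  semiflow0 : forall x, phi x 0 = x;
  semiflowD : forall x t s, 0 <= t -> 0 <= s ->
    phi x (t + s) = phi (phi x t) s
}.

(* [Phi x t0 t] is Phi_{t0,t}(x): [t0] is the initial time and [t] the elapsed
   time. *)
Record continuous_semiprocess (R : realType) (M : topologicalType)
    (Phi : M -> R -> R -> M) : Prop := ContinuousSemiprocess {
  semiprocess_continuous :
    {within [set p : M * R * R | 0 <= p.2],
      continuous (fun p => Phi p.1.1 p.1.2 p.2)};
  semiprocess_semiflow :
    continuous_semiflow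
      (fun (p : M * R) (t : R) => (Phi p.1 p.2 t, p.2 + t) : M * R)
}.

Definition half_trajectory (R : realType) (M : topologicalType)
    (Phi : M -> R -> R -> M) (tau : R) (x : M) : set (M * R) :=
  [set (Phi x 0 t, t) | t in [set t : R | 0 <= t < tau]].

(* The paper defines sigma(x) only for (x,0) in W or in the boundary of W; the
   value 0 elsewhere is a dummy. *)
Definition egress_time (R : realType) (M : topologicalType)
    (Phi : M -> R -> R -> M) (W : set (M * R)) (x : M) : \bar R :=
  if `[< W (x, 0) >] then
    ereal_sup [set tau%:E | tau in
      [set tau : R | 0 <= tau /\ half_trajectory Phi tau x `<=` W]]
  else 0%E.

(* (Phi_{0,s+t}(x), s+t) is outside of W and its boundary for small t > 0. *)
Definition leaves_after (R : realType) (M : topologicalType)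
    (Phi : M -> R -> R -> M) (W : set (M * R)) (x : M) (s : R) : Prop :=
  exists2 eps : R, 0 < eps &
    forall t, 0 < t < eps ->
      ~ (W `|` boundary W) (Phi x 0 (s + t), s + t).

(* [x] is an initial point by which [p] qualifies as an egress point. *)
Definition egress_from (R : realType) (M : topologicalType)
    (Phi : M -> R -> R -> M) (W : set (M * R)) (p : M * R) (x : M) : Prop :=
  [/\ 0 < p.2, W (x, 0), egress_time Phi W x = p.2%:E & p.1 = Phi x 0 p.2] \/
  [/\ p.2 = 0, p.1 = x & leaves_after Phi W x 0].

Definition egress_points (R : realType) (M : topologicalType)
    (Phi : M -> R -> R -> M) (W : set (M * R)) : set (M * R) :=
  [set p | boundary W p /\ exists x, egress_from Phi W p x].

(* In [leaves_after], [p.2] is sigma(x), by [egress_from]. *)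
Definition strict_egress_points (R : realType) (M : topologicalType)
    (Phi : M -> R -> R -> M) (W : set (M * R)) : set (M * R) :=
  [set p | boundary W p /\
    exists x, egress_from Phi W p x /\ leaves_after Phi W x p.2].

Definition time_section (R : realType) (M : topologicalType)
    (S : set (M * R)) (tau : R) : set (M * R) :=
  [set p | S p /\ p.2 = tau].

Definition equilibrium (R : realType) (M : topologicalType)
    (Phi : M -> R -> R -> M) (x0 : M) : Prop :=
  forall t0 t, 0 <= t0 -> 0 <= t -> Phi x0 t0 t = x0.

Definition uniformly_stable (R : realType) (M : topologicalType)
    (Phi : M -> R -> R -> M) (x0 : M) : Prop :=
  forall U : set M, open U -> U x0 ->
    exists V : set M, [/\ open V, V x0 &
      forall x t0 t, V x -> 0 <= t0 -> 0 <= t -> U (Phi x t0 t)].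

Definition globally_attractive (R : realType) (M : topologicalType)
    (Phi : M -> R -> R -> M) (x0 : M) : Prop :=
  forall x, Phi x 0 t @[t --> +oo] --> x0.

(* Main.v *)
(** Suppose [x0] is globally attractive. The initial points whose trajectory
    stays in [W] forever form an open set: after a finite time the trajectory
    enters a neighborhood of [x0] that stability traps in [U], and up to that
    time the tube lemma applies. The initial points whose trajectory leaves the
    closure of [W] also form an open set. A point of the path lies in one of
    the two, because strictness of the egress points forbids a trajectory to
    leave [W] while remaining in its closure. The first set contains [x0] and
    the second the other end of the path, contradicting connectedness. *)
Require Import Defs.
From HB Require Import structures.
From mathcomp Require Import all_boot all_order all_algebra.
From mathcomp Require Import all_classical all_reals all_analysis.
Import Order.TTheory GRing.Theory Num.Theory numFieldNormedType.Exports.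

Local Open Scope classical_set_scope.
Local Open Scope ring_scope.

Lemma setU_boundary (T : topologicalType) (A : set T) :
  open A -> A `|` boundary A = closure A.
Proof.
move=> oA; rewrite /boundary (interior_id A).1 // setDE setUIr setUCr setIT.
by apply/setUidPr; exact: subset_closure.
Qed.

Lemma connected_open_dichotomy (T : topologicalType) (C A B : set T) :
  connected C -> open A -> open B -> C `<=` A `|` B ->
  C `&` A !=set0 -> C `&` B !=set0 -> A `&` B !=set0.
Proof.
move=> Cc oA oB CAB CA [b [Cb Bb]]; apply/set0P/negP => /eqP AB0.
suff CAC : C `&` A = C.
  by rewrite -{1}CAC in Cb; rewrite -[False]/(set0 b) -AB0; case: Cb.
apply: Cc => //; first by exists A.
exists (~` B); first exact: open_closedC.
apply/seteqP; split => x [Cx]; split => //.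
  by move=> Bx; rewrite -[False]/(set0 x) -AB0.
by case: (CAB _ Cx).
Qed.

Section Semiprocess.
Set Implicit Arguments.
Unset Strict Implicit.
Variables (R : realType) (M : topologicalType) (Phi : M -> R -> R -> M).
Hypothesis hPhi : continuous_semiprocess Phi.

Lemma semiprocess0 x t0 : Phi x t0 0 = x.
Proof. by have [] := semiflow0 (semiprocess_semiflow hPhi) (x, t0). Qed.

Lemma semiprocessD x t0 t s : 0 <= t -> 0 <= s ->
  Phi x t0 (t + s) = Phi (Phi x t0 t) (t0 + t) s.
Proof.
by move=> t_ge0 s_ge0; have [] :=
  semiflowD (semiprocess_semiflow hPhi) (x, t0) t_ge0 s_ge0.
Qed.

(* Absolute values turn the semi-process, which is continuous only within
   nonnegative times, into a map that is continuous everywhere. *)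
Definition graph_map (p : M * R) : M * R := (Phi p.1 0 `|p.2|, `|p.2|).

Lemma graph_mapE x t : 0 <= t -> graph_map (x, t) = (Phi x 0 t, t).
Proof. by move=> t_ge0; rewrite /graph_map /= ger0_norm. Qed.

Lemma continuous_graph_map : continuous graph_map.
Proof.
move=> p.
have abs_p : (fun q : M * R => `|q.2|) @ p --> `|p.2|.
  by apply: continuous_comp; [exact: cvg_snd|exact: norm_continuous].
have cc : (fun q : M * R => (q.1, 0 : R, `|q.2|)) @ p --> (p.1, 0 : R, `|p.2|).
  exact: (cvg_pair (cvg_pair cvg_fst (cvg_cst _)) abs_p).
apply: (cvg_pair (f := fun q => Phi q.1 0 `|q.2|)) abs_p => /=.
have /subspace_continuousP/(_ (p.1, 0, `|p.2|)) := semiprocess_continuous hPhi.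
move=> /(_ (normr_ge0 _)) /=; apply: cvg_trans.
apply: (@cvg_comp _ _ _ (fun q : M * R => (q.1, 0 : R, `|q.2|))
  (fun q => Phi q.1.1 q.1.2 q.2)); last exact: cvg_id.
(* [B] is a neighborhood only within nonnegative times, a condition that [|q.2|] always meets. *)
move=> B nB; have cB : \forall q \near p, 0 <= `|q.2| -> B (q.1, 0, `|q.2|).
  exact: (cc _ nB).
by move: cB; apply: (@filterS _ (nbhs p)) => q; apply; exact: normr_ge0.
Qed.

Lemma continuous_graph_map_time x : continuous (fun t => graph_map (x, t)).
Proof.
move=> t; apply: (@continuous_comp _ _ _ (fun t => (x, t)) graph_map).
  exact: (cvg_pair (cvg_cst x) cvg_id).
exact: continuous_graph_map.
Qed.

Lemma open_graph_map_time (O : set (M * R)) (t : R) :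
  open O -> open [set x | O (graph_map (x, t))].
Proof.
move=> oO; apply: (@open_comp _ _ (fun x => graph_map (x, t))) => // x _.
apply: (@continuous_comp _ _ _ (fun x => (x, t)) graph_map).
  exact: (cvg_pair cvg_id (cvg_cst t)).
exact: continuous_graph_map.
Qed.

Section Window.
Variable W : set (M * R).
Hypothesis oW : open W.

Definition confined : set M :=
  [set x | forall t, 0 <= t -> W (Phi x 0 t, t)].

(** Leaving the closure, and not just [W], makes this an open condition on the initial point. *)
Definition escaping : set M :=
  [set x | exists2 t, 0 <= t & ~ closure W (Phi x 0 t, t)].

Lemma confined_escaping0 : confined `&` escaping = set0.
Proof.
by apply/seteqP; split => // x [cx [t t_ge0]]; apply; apply/subset_closure/cx.
Qed.

Lemma leaves_after_escaping x s : 0 <= s -> leaves_after Phi W x s ->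
  escaping x.
Proof.
move=> s_ge0 [e e_gt0 out]; exists (s + e / 2).
  by rewrite addr_ge0 // divr_ge0 // ltW.
rewrite -setU_boundary //; apply: out.
by rewrite divr_gt0 //= ltr_pdivrMr // ltr_pMr // ltr1n.
Qed.

Lemma open_escaping : open escaping.
Proof.
rewrite (_ : escaping = \bigcup_(t in [set t | 0 <= t])
  [set x | (~` closure W) (graph_map (x, t))]); last first.
  by apply/seteqP; split => x [t /= t_ge0 out]; exists t => //;
    move: out; rewrite /= graph_mapE.
apply: bigcup_open => t _; apply: open_graph_map_time.
exact/closed_openC/closed_closure.
Qed.

Lemma open_confined x0 (U : set M) : uniformly_stable Phi x0 ->
  globally_attractive Phi x0 -> open U -> U x0 ->
  U `*` [set: R] `<=` W -> open confined.
Proof.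
move=> stable attr oU Ux0 UW; rewrite openE => x cx.
have [V [oV Vx0 VU]] := stable U oU Ux0.
have [T T_ge0 VT] : exists2 T : R, 0 <= T & V (Phi x 0 T).
  have nV : \forall t \near +oo, V (Phi x 0 t).
    by apply: attr; exact: open_nbhs_nbhs.
  have [t [t_ge0 Vt]] : exists t : R, 0 <= t /\ V (Phi x 0 t).
    apply: (@filter_ex _ (pinfty_nbhs R)).
    by apply: filterI => //; exact: nbhs_pinfty_ge.
  by exists t.
have late : \forall y \near x, V (Phi y 0 T).
  have oVT : open [set y | V (graph_map (y, T)).1].
    apply: (open_graph_map_time (O := fst @^-1` V)).
    by apply: open_comp => // p _; exact: cvg_fst.
  have : nbhs x [set y | V (graph_map (y, T)).1].
    by apply: open_nbhs_nbhs; split => //=; rewrite ger0_norm.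
  by apply: filterS => y /=; rewrite ger0_norm.
(* Tube lemma: compactness of the time segment yields one neighborhood of [x] valid for all times up
   to [T]. *)
have early : \forall y \near x, `[0, T] `<=` (fun t => W (graph_map (y, t))).
  apply: (compact_near_coveringP _).1; first exact: segment_compact.
  move=> t /=; rewrite in_itv /= => /andP[t_ge0 _].
  have nW : nbhs (x, t) (graph_map @^-1` W).
    apply: continuous_graph_map; rewrite graph_mapE //.
    by apply: open_nbhs_nbhs; split => //; exact: cx.
  have [[A B] /= [nA nB] AB] := nW.
  by exists (B, A) => // -[t' y] [/= Bt Ay]; exact: (AB (y, t')).
move: late early; apply: filterS2 => y late early t t_ge0.
have [tT|/ltW Tt] := leP t T.
  rewrite -graph_mapE //; apply: early.
  by rewrite /= in_itv /= t_ge0 tT.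
(* The trajectory restarts at time [T] from a point of [V]; stability is applied with initial time
   [T], whence its uniformity. *)
apply: UW; split => //=; rewrite -(subrKC T t) semiprocessD ?subr_ge0 //.
rewrite add0r; by apply: VU; rewrite ?subr_ge0.
Qed.

(** The supremum [s] of the times up to which the trajectory stays in [W] is finite, being bounded
    by any time outside [W]. As [W] is open, the point reached at [s] is not in [W], yet it is a
    limit of earlier points in [W]. *)
Lemma egress_point_exists x : W (x, 0) -> ~ confined x ->
  exists s, [/\ 0 < s, boundary W (Phi x 0 s, s) & egress_time Phi W x = s%:E].
Proof.
move=> Wx /existsNP[t0 /not_implyP[t0_ge0 Wt0]].
pose S := [set tau : R | 0 <= tau /\ half_trajectory Phi tau x `<=` W].
(* The half-trajectory over the empty time interval is empty. *)
have S0 : S 0.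
  by split => // p [t /=] /andP[/le_lt_trans lt_t] /lt_t; rewrite ltxx.
have supS : has_sup S.
  split; first by exists 0.
  exists t0 => tau [tau_ge0 stau]; rewrite leNgt; apply/negP => t0tau.
  by apply: Wt0; apply: stau; exists t0 => //=; rewrite t0_ge0.
pose s := sup S; have s_ge0 : 0 <= s by apply: ub_le_sup S0; exact: supS.2.
have before t : 0 <= t -> t < s -> W (Phi x 0 t, t).
  move=> t_ge0 ts.
  have /(sup_adherent)/(_ supS) : 0 < s - t by rewrite subr_gt0.
  rewrite subKr => -[tau [_ stau] ttau].
  by apply: stau; exists t => //=; rewrite t_ge0.
have nWs : ~ W (Phi x 0 s, s).
  move=> Ws.
  have : nbhs s [set t | W (graph_map (x, t))].
    apply: continuous_graph_map_time; rewrite graph_mapE //.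
    exact: open_nbhs_nbhs.
  move=> /nbhs_ballP[e /= e_gt0 se].
  (* Times below [s + e / 2] are either before [s] or in the ball around [s], so the supremum would
     be exceeded. *)
  suff : S (s + e / 2).
    move=> /(ub_le_sup supS.2); rewrite -/s gerDl leNgt divr_gt0 //.
  split; first by rewrite addr_ge0 // divr_ge0 // ltW.
  move=> _ [t /= /andP[t_ge0 tse] <-].
  have [ts|st] := ltP t s; first exact: before.
  rewrite -graph_mapE //; apply: se; rewrite /ball /= ltr_distlC.
  rewrite (lt_le_trans _ st) ?ltrBlDr ?ltrDl //=.
  by apply: lt_trans tse _; rewrite ltrD2l ltr_pdivrMr // ltr_pMr // ltr1n.
have s_gt0 : 0 < s.
  rewrite lt_neqAle s_ge0 andbT; apply/eqP => s0.
  by apply: nWs; rewrite -s0 semiprocess0.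
exists s; split => //.
- split; last by rewrite (interior_id W).1.
  move=> B nB.
  have : nbhs s [set t | B (graph_map (x, t))].
    by apply: continuous_graph_map_time; rewrite graph_mapE.
  move=> /nbhs_ballP[e /= e_gt0 se].
  (* [s - e / 2] may be negative; the maximum is a valid time, still below [s] and in the ball. *)
  pose t := Num.max 0 (s - e / 2).
  have t_ge0 : 0 <= t by rewrite le_max lexx.
  have ts : t < s by rewrite gt_max s_gt0 /= ltrBlDr ltrDl divr_gt0.
  exists (Phi x 0 t, t); split; first exact: before.
  rewrite -graph_mapE //; apply: se; rewrite /ball /= ltr_distlC.
  rewrite (lt_trans ts) ?ltrDl // andbT lt_max; apply/orP; right.
  by rewrite ltrD2l ltrN2 ltr_pdivrMr // ltr_pMr // ltr1n.
- rewrite /egress_time asboolT // ereal_sup_EFin //; first exact: supS.2.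
  by exists 0.
Qed.

(** By the semi-process law, the future depends only on the point reached at time [s]. *)
Lemma leaves_after_same_point x y s : 0 <= s -> Phi x 0 s = Phi y 0 s ->
  leaves_after Phi W x s -> leaves_after Phi W y s.
Proof.
move=> s_ge0 xy [e e_gt0 out]; exists e => // t te.
have /andP[t_gt0 _] := te.
by move: (out t te); rewrite !semiprocessD ?(ltW t_gt0) // xy.
Qed.

Lemma confined_or_escaping x :
  egress_points Phi W = strict_egress_points Phi W ->
  W (x, 0) -> confined x \/ escaping x.
Proof.
move=> eqW Wx; have [|ncx] := pselect (confined x); [by left|right].
have [s [s_gt0 bs es]] := egress_point_exists Wx ncx.
have : egress_points Phi W (Phi x 0 s, s).
  by split => //; exists x; left.
(* Strictness may be witnessed by another initial point [y] reaching the same point, so the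
   departure is transferred to [x]. *)
rewrite eqW => -[_ [y [[[/= _ _ _ xy]|[/= s0 _ _]] leave]]].
  apply: (leaves_after_escaping (ltW s_gt0)).
  by apply: leaves_after_same_point leave => //; exact: ltW.
by rewrite s0 ltxx in s_gt0.
Qed.

End Window.
End Semiprocess.

Theorem theorem2p13 (R : realType) (n : nat) (M : smooth_manifold R n)
    (Phi : M -> R -> R -> M) (hPhi : continuous_semiprocess Phi)
    (W : set (M * R)) (hW : open W)
    (hW0 : time_section W 0 !=set0)
    (hWeq : egress_points Phi W = strict_egress_points Phi W)
    (hWs0 : time_section (strict_egress_points Phi W) 0 !=set0)
    (x0 : M) (heq : equilibrium Phi x0) (hst : uniformly_stable Phi x0)
    (U : set M) (hU : open U) (hUx0 : U x0)
    (hUW : closure U `*` [set: R] `<=` W)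
    (hGamma : exists Gamma : R -> M * R,
      [/\ {within `[0, 1], continuous Gamma},
          forall s, 0 < s < 1 -> time_section W 0 (Gamma s),
          Gamma 0 = (x0, 0) &
          time_section (strict_egress_points Phi W) 0 (Gamma 1)]) :
  ~ globally_attractive Phi x0.
Proof.
move=> attr; have [Gamma [cG WG G0 [[_ [y [yG leave]]] G1]]] := hGamma.
have UW : U `*` [set: R] `<=` W.
  by move=> p [Up _]; apply: hUW; split => //; exact: subset_closure.
have cx0 : confined Phi W x0.
  by move=> t t_ge0; apply: UW; split => //=; rewrite heq.
have eG1 : escaping Phi W (Gamma 1).1.
  (* At time 0 only the second case of [egress_from] is possible, and it identifies the two
     points. *)
  have -> : (Gamma 1).1 = y.
    by case: yG => [[]|[]//]; rewrite G1 ltxx.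
  by apply: leaves_after_escaping leave => //; rewrite G1.
have conn : connected ((fst \o Gamma) @` `[0, 1]).
  apply: connected_continuous_connected; first exact: segment_connected.
  apply/subspace_continuousP => s s01.
  have /subspace_continuousP/(_ s s01) cGs := cG.
  rewrite /from_subspace in cGs *.
  by apply: cvg_comp cGs _; exact: cvg_fst.
apply/eqP: (confined_escaping0 Phi W); apply/set0P.
apply: (connected_open_dichotomy _ _ _ _ conn).
- exact: open_confined hst attr hU hUx0 UW.
- exact: open_escaping.
(* The endpoints are treated apart: only the interior of the path is assumed to lie in [W]. *)
- move=> _ [s /= + <-]; rewrite in_itv /= => /andP[].
  rewrite le_eqVlt => /predU1P[<- _|s_gt0]; first by left; rewrite G0.
  rewrite le_eqVlt => /predU1P[->|s_lt1]; first by right.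
  have [|] := WG s _; first by rewrite s_gt0.
  case: (Gamma s) => x t /= + t0; rewrite t0 => Wx.
  exact: confined_or_escaping.
- exists x0; split => //; exists 0; first by rewrite /= in_itv /= lexx ler01.
  by rewrite /= G0.
- exists (Gamma 1).1; split => //; exists 1 => //.
  by rewrite /= in_itv /= lexx ler01.
Qed.
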